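(* Let $d\geq1$, $N\geq 2$, and let $x_1,\ldots,x_N$ be a collection of points in $[0,1]^d$ (repetitions allowed). For any integer $1\leq n\leq N$, let $\mathcal{G}_n$ be the collection of all subsets $\tau$ of $\{1,\ldots,N\}$ of cardinality $n$, equipped with the uniform probability measure $\pi_n$, and for $\tau\in\mathcal{G}_n$ let $\mu_\tau=\frac1n\sum_{j\in\tau}\delta_{x_j}$. Let $\mu=\frac1N\sum_{j=1}^N\delta_{x_j}$. Then $$ \mathbb{E}_{\pi_n}\big(\mathrm{W}_1(\mu_\tau,\mu)\big)\ \leq\ \begin{cases} \sqrt{\frac2n} & \text{if } d=1,\\ 8\,\sqrt{\frac{1+\log(2n)}{n}} & \text{if } d=2,\\ \frac{13\sqrt d}{n^{1/d}} & \text{if } d\geq3. \end{cases} $$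
   Context: For Borel probability measures $\mu,\nu$ on $\mathbb{R}^d$ with finite first moment, $\mathrm{W}_1(\mu,\nu)=\inf_\lambda \int_{\mathbb{R}^d}\int_{\mathbb{R}^d}|x-y|\,d\lambda(x,y)$, where the infimum is over all probability measures $\lambda$ on $\mathbb{R}^d\times\mathbb{R}^d$ with marginals $\mu$ and $\nu$, and $|\cdot|$ is the Euclidean norm. $\mathbb{E}_{\pi_n}$ denotes the expectation over $\tau$ chosen according to $\pi_n$, i.e. the average over all $\tau\in\mathcal{G}_n$. *)

(* Defs.v *)
From HB Require Import structures.
From mathcomp Require Import all_boot all_order all_algebra.
From mathcomp Require Import all_classical all_reals all_analysis.

Set Implicit Arguments.
Unset Strict Implicit.
Unset Printing Implicit Defensive.

Import Order.TTheory GRing.Theory Num.Theory.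
Import numFieldNormedType.Exports.

Local Open Scope classical_set_scope.
Local Open Scope ring_scope.

(* R^d with its Borel sigma-algebra.  The library topology on 'rV[R]_d comes
   from the sup norm; it is the Euclidean topology. *)
Definition borelRV (R : realType) (d : nat) :=
  g_sigma_algebraType (@open 'rV[R]_d).

(* The canonical norm `|v| on 'rV[R]_d is the sup norm, hence this one. *)
Definition euclidean_norm (R : realType) (d : nat) (v : 'rV[R]_d) : R :=
  Num.sqrt (\sum_(i < d) v ord0 i ^+ 2).

Section wasserstein.
Context (R : realType) (d : nat).
Local Notation E := (borelRV R d).
Implicit Types mu nu : {measure set E -> \bar R}.

Definition coupling mu nu : set (probability (E * E)%type R) :=
  [set lambda | (forall A : set E, measurable A -> lambda (A `*` setT) = mu A)
             /\ (forall B : set E, measurable B -> lambda (setT `*` B) = nu B)].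

(* [mu] and [nu] are meant to be probability measures; otherwise there is no
   coupling and the infimum is +oo. *)
Definition W1 mu nu : \bar R :=
  ereal_inf [set (\int[lambda]_z
      (euclidean_norm ((z.1 : 'rV[R]_d) - (z.2 : 'rV[R]_d)))%:E)%E
    | lambda in coupling mu nu].

End wasserstein.

Section empirical_measure.
Context (R : realType) (d N : nat) (x : 'I_N -> 'rV[R]_d) (tau : {set 'I_N}).
Local Open Scope ereal_scope.

(* When [tau] is empty this is the zero measure. *)
Definition empirical (A : set (borelRV R d)) : \bar R :=
  (#|tau|%:R^-1)%:E * \sum_(j in tau) \d_(x j : borelRV R d) A.

Let empirical0 : empirical set0 = 0.
Proof. by rewrite /empirical big1 ?mule0// => j _; rewrite measure0. Qed.

Let empirical_ge0 A : 0 <= empirical A.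
Proof.
apply: mule_ge0; first by rewrite lee_fin invr_ge0 ler0n.
by apply: sume_ge0 => j _; exact: measure_ge0.
Qed.

Let empirical_sigma_additive : semi_sigma_additive empirical.
Proof.
move=> F mF tF mUF; rewrite /empirical.
rewrite [X in X @ \oo --> _](_ : _ = (fun k => (#|tau|%:R^-1)%:E *
    \sum_(j in tau) \sum_(0 <= i < k) \d_(x j : borelRV R d) (F i))); last first.
  apply/funext => k; rewrite exchange_big/= ge0_sume_distrr// => i _.
  by apply: sume_ge0 => j _; exact: measure_ge0.
apply: cvgeZl => //; apply: cvg_nnesum => [j _|j _].
  by apply: nearW => k; apply: sume_ge0 => i _; exact: measure_ge0.
exact: measure_semi_sigma_additive.
Qed.

HB.instance Definition _ := isMeasure.Build _ _ _
  empirical empirical0 empirical_ge0 empirical_sigma_additive.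

Lemma empirical_setT : tau != finset.set0 -> empirical setT = 1.
Proof.
move=> tau0; rewrite /empirical.
under eq_bigr do rewrite diracT.
rewrite sumEFin -EFinM sumr_const mulVf// pnatr_eq0.
by rewrite cards_eq0.
Qed.

End empirical_measure.
Arguments empirical {R d N} x tau A.

Definition subsets_of_card (N n : nat) : {set {set 'I_N}} :=
  [set tau : {set 'I_N} | #|tau| == n].

(* Expectation of [f] under the uniform probability measure on [G]. *)
Definition average (R : realType) (T : finType) (G : {set T})
    (f : T -> \bar R) : \bar R :=
  ((#|G|%:R^-1)%:E * \sum_(t in G) f t)%E.

(* Main.v *)
From HB Require Import structures.
Require Import Defs.
From mathcomp Require Import all_boot all_order all_algebra.
From mathcomp Require Import all_classical all_reals all_analysis.
From mathcomp Require Import measurable_realfun.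
From mathcomp Require Import ring lra zify.

Set Implicit Arguments.
Unset Strict Implicit.
Unset Printing Implicit Defensive.

Import Order.TTheory GRing.Theory Num.Theory.
Import numFieldNormedType.Exports.

Local Open Scope ring_scope.

(** The discrepancy between a sample and the whole population is paid for by
    a flow on a fine grid, and the flow is linear in the discrepancy; this is
    what lets the random signs cancel before any absolute value is taken.

    Let M = 2 ^ L and divide the unit cube into M ^ d cells.  Each point x_j
    is first carried to a nearby grid point, at distance at most sqrt d / M;
    since the two measures have mass 1, doing this and undoing it for mu costs
    at most 2 sqrt d / M.  From the grid point p, a unit mass is then spread
    over the whole grid along grid edges: at scale k, it passes from the
    uniform law on the dyadic cube of side 2 ^ k around p to the uniform law on
    the cube of side 2 ^ (k + 1), one coordinate after the other.  Let theta_p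
    be the total flow.  It ends at a law that does not depend on p
    ([grid_flow_div]), so that the flow sum_j (mu_tau - mu)(j) theta_(x_j)
    transports mu_tau onto mu.  A flow of divergence mu_tau - mu can be turned
    into a coupling of no greater cost ([plan_of_flow], [W1_le_flow]), hence
    W1 is at most the l1 norm of this flow divided by M, plus the cost of
    reaching the grid ([W1_empirical_le]).

    On each edge, the flow is the deviation of a sample mean from a population
    mean, and sampling without replacement gives a second moment of at most
    the population mean of theta_(x_j) ^ 2 divided by n ([sampling_variance]).
    By Cauchy-Schwarz over the d M ^ d edges, the expected l1 norm is at most
    sqrt (d M ^ d K / n), where K bounds the energy of every theta_p.

    The part of theta_p coming from scale k has l1 norm at most 2 ^ k and
    sup norm at most 2 ^ k (2 ^ - k) ^ d, up to a factor decreasing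
    geometrically with the coordinate, so that two scales interact only weakly
    and K is of order sum_(k < L) (4 / 2 ^ d) ^ k ([sum_sqr_grid_flow_dir]).
    This is of order M for d = 1, equal to L up to a constant for d = 2 (the
    origin of the logarithm), and bounded for d >= 3.  The theorem follows from
    [average_W1_le] by letting M be exponentially large in n for d = 1, of
    order sqrt n for d = 2, and of order n ^ (1 / d) for d >= 3. *)

(** * From flows to transport plans *)
Section Rerouting.
Context (R : realFieldType) (V : finType) (c : V -> V -> R).
Hypothesis c_refl : forall u, c u u = 0.
Hypothesis c_triangle : forall u v w, c u w <= c u v + c v w.
Implicit Types (theta : V -> V -> R) (v : V).

Definition inflow theta v i := if i == v then 0 else theta i v.
Definition outflow theta v j := if j == v then 0 else theta v j.
Definition throughput theta v :=
  Num.max (\sum_i inflow theta v i) (\sum_j outflow theta v j).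

(** The flow is diverted so that it no longer passes through [v]: each unit
    arriving from [i] continues directly to [j], in proportion to the outflow.
    With the throughput (the larger of the two totals) as denominator, one
    formula covers both signs of the imbalance at [v], and whatever cannot be
    matched stays on the edges at [v].  A zero throughput makes the inflow and
    the outflow vanish, and the quotients by it only occur multiplied by
    them. *)
Definition reroute v theta i j :=
  let p := inflow theta v in let q := outflow theta v in
  let m := throughput theta v in
  if i == v then (if j == v then 0 else q j * (1 - (\sum_k p k) / m))
  else if j == v then p i * (1 - (\sum_k q k) / m)
  else theta i j + p i * q j / m.

Lemma inflow_ge0 theta v i :
  (forall i j, 0 <= theta i j) -> 0 <= inflow theta v i.
Proof. by rewrite /inflow; case: ifP. Qed.

Lemma outflow_ge0 theta v j :
  (forall i j, 0 <= theta i j) -> 0 <= outflow theta v j.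
Proof. by rewrite /outflow; case: ifP. Qed.

(** A diverted unit trades the legs from [i] to [v] and from [v] to [j] for the
    leg from [i] to [j].  Taking for [phi] a difference of potentials, the
    correction vanishes and the divergence is unchanged; taking for [phi] a
    distance, it is nonpositive by the triangle inequality. *)
Lemma sum_reroute v theta (phi : V -> V -> R) :
  phi v v = 0 ->
  \sum_i \sum_j reroute v theta i j * phi i j =
  \sum_i \sum_j theta i j * phi i j +
  \sum_i \sum_j inflow theta v i * outflow theta v j / throughput theta v *
    (phi i j - phi i v - phi v j).
Proof.
move=> phi0.
set p := inflow theta v; set q := outflow theta v.
set m := throughput theta v.
have E i j : reroute v theta i j * phi i j = theta i j * phi i j
    + p i * q j / m * phi i j
    + ((if j == v then - (p i * phi i v * ((\sum_k q k) / m)) else 0)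
    + (if i == v then - (q j * phi v j * ((\sum_k p k) / m)) else 0)).
  rewrite /reroute -/p -/q -/m.
  have [->|iv] := eqVneq i v; have [->|jv] := eqVneq j v; rewrite ?phi0.
  - by rewrite /p /q /inflow /outflow eqxx; ring.
  - by rewrite /p /q /inflow /outflow eqxx (negPf jv); ring.
  - by rewrite /p /q /inflow /outflow eqxx (negPf iv); ring.
  - by ring.
under eq_bigr do under eq_bigr do rewrite E.
under eq_bigr do rewrite !big_split/=.
rewrite !big_split/= -!addrA; congr (_ + _).
under [in RHS]eq_bigr do under eq_bigr do rewrite !mulrBr.
under [in RHS]eq_bigr do rewrite !sumrB.
rewrite !sumrB -!addrA; congr (_ + (_ + _)).
  rewrite -sumrN; apply: eq_bigr => i _.
  rewrite -big_mkcond/= big_pred1_eq mulrA mulr_sumr mulr_suml; congr (- _).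
  by apply: eq_bigr => k _; ring.
rewrite exchange_big/= [in RHS]exchange_big/= -sumrN; apply: eq_bigr => j _.
rewrite -big_mkcond/= big_pred1_eq mulrA mulr_sumr mulr_suml; congr (- _).
by apply: eq_bigr => k _; ring.
Qed.

Lemma reroute_ge0 v theta :
  (forall i j, 0 <= theta i j) -> forall i j, 0 <= reroute v theta i j.
Proof.
move=> th0 i j; rewrite /reroute.
set p := inflow theta v; set q := outflow theta v; set m := throughput theta v.
have p0 k : 0 <= p k by exact: inflow_ge0.
have q0 k : 0 <= q k by exact: outflow_ge0.
have m0 : 0 <= m by rewrite /m /throughput le_max sumr_ge0.
have frac x : 0 <= x -> x <= m -> 0 <= 1 - x / m.
  move=> x0 xm; rewrite subr_ge0; have [->|mn0] := eqVneq m 0.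
    by rewrite invr0 mulr0 ler01.
  by rewrite ler_pdivrMr ?mul1r// lt_def mn0.
have pm : \sum_k p k <= m by rewrite /m /throughput le_max lexx.
have qm : \sum_k q k <= m by rewrite /m /throughput le_max lexx orbT.
have fp := frac _ (sumr_ge0 _ (fun k _ => p0 k)) pm.
have fq := frac _ (sumr_ge0 _ (fun k _ => q0 k)) qm.
case: ifP => _; case: ifP => _ //; try exact: mulr_ge0.
by rewrite addr_ge0// divr_ge0// mulr_ge0.
Qed.

(** Once every vertex is a pure source or a pure sink, no mass passes through
    any vertex and the flow can be read as a transport plan. *)
Definition settled theta v :=
  (forall i, theta i v = 0) \/ (forall j, theta v j = 0).

(** If the outflow is the throughput, all the inflow is absorbed by it, and
    symmetrically. *)
Lemma reroute_settled v theta :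
  (forall i j, 0 <= theta i j) -> settled (reroute v theta) v.
Proof.
move=> th0; rewrite /settled /reroute eqxx.
set p := inflow theta v; set q := outflow theta v; set m := throughput theta v.
have p0 k : 0 <= p k by exact: inflow_ge0.
have q0 k : 0 <= q k by exact: outflow_ge0.
have full (f : V -> R) : (forall k, 0 <= f k) -> m = \sum_k f k ->
    forall g, (forall k, 0 <= g k) -> \sum_k g k <= m ->
    forall k, g k * (1 - (\sum_k f k) / m) = 0.
  move=> f0 mE g g0 gm k; rewrite -mE.
  have [m_eq0|mn0] := eqVneq m 0; last by rewrite divff// subrr mulr0.
  suff -> : g k = 0 by rewrite mul0r.
  apply/eqP; rewrite eq_le g0 andbT -m_eq0; apply: le_trans gm.
  by rewrite (bigD1 k)//= lerDl sumr_ge0.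
have [pq|qp] := leP (\sum_k p k) (\sum_k q k).
  left => i; case: ifP => // _; apply: full => //.
    by rewrite /m /throughput max_r.
  by rewrite /m /throughput le_max lexx.
right=> j; case: ifP => // _; apply: full => //.
  by rewrite /m /throughput max_l// ltW.
by rewrite /m /throughput le_max lexx orbT.
Qed.

(** New edges join a vertex that sends flow to a vertex that receives some, so
    a source never starts receiving and a sink never starts sending. *)
Lemma settled_reroute v w theta :
  settled theta w -> settled (reroute v theta) w.
Proof.
have [<-|vw] := eqVneq v w.
  case=> th0; [left=> i|right=> j]; rewrite /reroute eqxx; case: ifP => // _.
    by rewrite /inflow th0 if_same mul0r.
  by rewrite /outflow th0 if_same mul0r.
have wv : (w == v) = false by rewrite eq_sym (negPf vw).
case=> th0; [left=> i|right=> j]; rewrite /reroute wv.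
  by rewrite th0 /outflow wv th0 mulr0 !mul0r addr0 if_same.
by rewrite th0 /inflow wv th0 !mul0r addr0 if_same.
Qed.

Lemma reroute_all theta : (forall i j, 0 <= theta i j) ->
  exists theta', [/\ forall i j, 0 <= theta' i j,
    forall psi : V -> R, \sum_i \sum_j theta' i j * (psi i - psi j) =
      \sum_i \sum_j theta i j * (psi i - psi j),
    \sum_i \sum_j theta' i j * c i j <= \sum_i \sum_j theta i j * c i j &
    forall v, settled theta' v].
Proof.
move=> th0.
suff [theta' [t0 tn tc ts]] : exists theta', [/\ forall i j, 0 <= theta' i j,
    forall psi : V -> R, \sum_i \sum_j theta' i j * (psi i - psi j) =
      \sum_i \sum_j theta i j * (psi i - psi j),
    \sum_i \sum_j theta' i j * c i j <= \sum_i \sum_j theta i j * c i j &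
    {in enum V, forall v, settled theta' v}].
  by exists theta'; split=> // v; apply: ts; rewrite mem_enum.
elim: (enum V) => [|v s [t [t0 tn tc ts]]]; first by exists theta.
exists (reroute v t); split.
- exact: reroute_ge0.
- move=> psi; rewrite sum_reroute ?subrr// tn [X in _ + X]big1 ?addr0// => i _.
  by rewrite big1// => j _; ring.
- rewrite sum_reroute//; apply: le_trans tc; rewrite gerDl.
  apply: sumr_le0 => i _; apply: sumr_le0 => j _.
  apply: mulr_ge0_le0; last by have := c_triangle i v j; lra.
  rewrite divr_ge0 ?mulr_ge0 ?inflow_ge0 ?outflow_ge0//.
  by rewrite /throughput le_max sumr_ge0// => k _; exact: inflow_ge0.
- move=> w; rewrite inE => /orP[/eqP->|ws]; first exact: reroute_settled.
  by apply: settled_reroute; exact: ts.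
Qed.

(** When all vertices are settled, the flow sends the positive part of [a - b]
    to its negative part, and the mass common to [a] and [b] stays in place. *)
Lemma plan_of_flow (a b : V -> R) theta :
  (forall v, 0 <= a v) -> (forall v, 0 <= b v) ->
  (forall i j, 0 <= theta i j) ->
  (forall psi : V -> R, \sum_i \sum_j theta i j * (psi i - psi j) =
     \sum_v (a v - b v) * psi v) ->
  exists pi : V -> V -> R, [/\ forall i j, 0 <= pi i j,
    forall i, \sum_j pi i j = a i, forall j, \sum_i pi i j = b j &
    \sum_i \sum_j pi i j * c i j <= \sum_i \sum_j theta i j * c i j].
Proof.
move=> a0 b0 th0 net; have [t [t0 tn tc ts]] := reroute_all th0.
have netv v : \sum_j t v j - \sum_i t i v = a v - b v.
  transitivity (\sum_i \sum_j t i j * ((i == v)%:R - (j == v)%:R)).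
    under [RHS]eq_bigr do under eq_bigr do rewrite mulrBr.
    under [RHS]eq_bigr do rewrite sumrB.
    rewrite sumrB; congr (_ - _).
      rewrite [in RHS](bigD1 v)//= [X in _ = _ + X]big1 ?addr0.
        by apply: eq_bigr => j _; rewrite eqxx mulr1.
      by move=> i /negPf iv; rewrite big1// => j _; rewrite iv mulr0.
    apply: eq_bigr => i _; rewrite [in RHS](bigD1 v)//= eqxx mulr1 big1 ?addr0//.
    by move=> j /negPf ->; rewrite mulr0.
  rewrite (tn (fun u => (u == v)%:R)) net (bigD1 v)//= eqxx mulr1 big1 ?addr0//.
  by move=> j /negPf ->; rewrite mulr0.
have diagl i (f : V -> R) : \sum_j (if i == j then f j else 0) = f i.
  by rewrite -big_mkcond/= (big_pred1 i)// => j; rewrite eq_sym.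
have diagr j (f : V -> R) : \sum_i (if i == j then f j else 0) = f j.
  by rewrite -big_mkcond/= (big_pred1 j).
exists (fun i j => t i j + if i == j then Num.min (a j) (b j) else 0); split.
- move=> i j; rewrite addr_ge0//; case: ifP => // _.
  by rewrite le_min a0 b0.
- move=> v; rewrite big_split/= (diagl _ (fun j => Num.min (a j) (b j))).
  have := netv v; case: (ts v) => z.
    have : 0 <= \sum_j t v j by exact: sumr_ge0.
    by move=> s0; rewrite [\sum_i t i v]big1// => e; rewrite min_r; lra.
  have : 0 <= \sum_i t i v by exact: sumr_ge0.
  by move=> s0; rewrite [\sum_j t v j]big1// => e; rewrite min_l; lra.
- move=> v; rewrite big_split/= (diagr _ (fun j => Num.min (a j) (b j))).
  have := netv v; case: (ts v) => z.
    have : 0 <= \sum_j t v j by exact: sumr_ge0.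
    by move=> s0; rewrite [\sum_i t i v]big1// => e; rewrite min_r; lra.
  have : 0 <= \sum_i t i v by exact: sumr_ge0.
  by move=> s0; rewrite [\sum_j t v j]big1// => e; rewrite min_l; lra.
- apply: le_trans tc; apply: ler_sum => i _; apply: ler_sum => j _.
  by case: eqP => [->|_]; rewrite ?c_refl ?mulr0// addr0.
Qed.

End Rerouting.

(** * Cauchy-Schwarz and the Euclidean norm *)
(** Lagrange's identity: the difference of the two sides is half the sum of the
    squares [(a i * b j - a j * b i) ^+ 2]. *)
Lemma cauchy_schwarz_sum (R : realFieldType) (I : finType) (a b : I -> R) :
  (\sum_i a i * b i) ^+ 2 <= (\sum_i a i ^+ 2) * (\sum_i b i ^+ 2).
Proof.
have : 0 <= \sum_i \sum_j (a i * b j - a j * b i) ^+ 2.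
  by apply: sumr_ge0 => i _; apply: sumr_ge0 => j _; exact: sqr_ge0.
have -> : \sum_i \sum_j (a i * b j - a j * b i) ^+ 2 =
    \sum_i \sum_j (a i ^+ 2 * b j ^+ 2) + \sum_i \sum_j (b i ^+ 2 * a j ^+ 2)
    - 2 * \sum_i \sum_j ((a i * b i) * (a j * b j)).
  rewrite mulr_sumr -big_split -sumrB/=; apply: eq_bigr => i _.
  rewrite mulr_sumr -big_split -sumrB/=; apply: eq_bigr => j _.
  by ring.
by rewrite -!big_distrlr/= expr2; lra.
Qed.

Lemma sqr_sum_le (R : realFieldType) (I : finType) (P : pred I) (y : I -> R) :
  (\sum_(i | P i) y i) ^+ 2 <= #|P|%:R * \sum_(i | P i) y i ^+ 2.
Proof.
have := cauchy_schwarz_sum (fun i => (P i)%:R : R)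
  (fun i => if P i then y i else 0).
have -> : \sum_i (P i)%:R ^+ 2 = #|P|%:R :> R.
  rewrite -sum1_card natr_sum [RHS]big_mkcond/=; apply: eq_bigr => i _.
  by rewrite unfold_in; case: (P i); rewrite ?expr1n ?expr0n.
have -> : \sum_i (if P i then y i else 0) ^+ 2 = \sum_(i | P i) y i ^+ 2.
  by rewrite [RHS]big_mkcond; apply: eq_bigr => i _; case: (P i); rewrite ?expr0n.
have -> // : \sum_i (P i)%:R * (if P i then y i else 0) = \sum_(i | P i) y i.
by rewrite [RHS]big_mkcond; apply: eq_bigr => i _; case: (P i); rewrite ?mul1r ?mulr0.
Qed.

Section EuclideanNorm.
Context (R : realType) (d : nat).
Implicit Types u v : 'rV[R]_d.

Lemma euclidean_normD u v :
  euclidean_norm (u + v) <= euclidean_norm u + euclidean_norm v.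
Proof.
rewrite /euclidean_norm.
set A := \sum_i u ord0 i ^+ 2; set B := \sum_i v ord0 i ^+ 2.
have A0 : 0 <= A by apply: sumr_ge0 => i _; exact: sqr_ge0.
have B0 : 0 <= B by apply: sumr_ge0 => i _; exact: sqr_ge0.
have -> : \sum_i (u + v) ord0 i ^+ 2 = A + B + 2 * \sum_i u ord0 i * v ord0 i.
  rewrite mulr_sumr -!big_split/=; apply: eq_bigr => i _.
  by rewrite mxE; ring.
rewrite -[leRHS]ger0_norm ?addr_ge0 ?sqrtr_ge0// -sqrtr_sqr ler_wsqrtr//.
have -> : (Num.sqrt A + Num.sqrt B) ^+ 2 = A + B + 2 * (Num.sqrt A * Num.sqrt B).
  by rewrite sqrrD !sqr_sqrtr//; ring.
rewrite lerD2l ler_wpM2l// -sqrtrM// (le_trans (ler_norm _))//.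
by rewrite -sqrtr_sqr ler_wsqrtr// cauchy_schwarz_sum.
Qed.

Lemma euclidean_norm0 : euclidean_norm (0 : 'rV[R]_d) = 0.
Proof.
by rewrite /euclidean_norm big1 ?sqrtr0// => i _; rewrite mxE expr0n.
Qed.

Lemma euclidean_norm_le (e : R) v :
  0 <= e -> (forall i, `|v ord0 i| <= e) ->
  euclidean_norm v <= Num.sqrt d%:R * e.
Proof.
move=> e0 ve; rewrite /euclidean_norm -[e in leRHS](ger0_norm e0) -sqrtr_sqr.
rewrite -sqrtrM// ler_wsqrtr//.
have -> : d%:R * e ^+ 2 = \sum_(i < d) e ^+ 2.
  by rewrite sumr_const card_ord mulr_natl.
by apply: ler_sum => i _; rewrite -[leLHS]real_normK ?num_real// lerXn2r ?nnegrE.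
Qed.

End EuclideanNorm.

(** * Sampling without replacement *)
Section Sampling.
Context (R : realFieldType) (N n : nat).
Local Notation G := (subsets_of_card N n).

Lemma card_subsets_split (P Q : pred {set 'I_N}) :
  #|[set t in G | P t]| =
  (#|[set t in G | P t && Q t]| + #|[set t in G | P t && ~~ Q t]|)%N.
Proof.
rewrite -(cardsID [set t | Q t]); congr (_ + _)%N;
  by apply: eq_card => t; rewrite !inE; case: (P t); case: (Q t);
    rewrite ?andbT ?andbF.
Qed.

(** The subsets that avoid [i] are the n-subsets of an (N - 1)-set. *)
Lemma card_subsets_containing (hn : (1 <= n <= N)%N) (i : 'I_N) :
  (N * #|[set t in G | i \in t]| = n * #|G|)%N.
Proof.
have notin : #|[set t in G | i \notin t]| = 'C(N.-1, n).
  rewrite -[N in RHS]card_ord -(cardsC1 i) -cards_draws.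
  apply: eq_card => t; rewrite !inE andbC; congr (_ && _).
  by rewrite finset.subsetC finset.sub1set inE.
have cG : #|G| = 'C(N, n) by rewrite /subsets_of_card card_draws card_ord.
have split : #|[set t in G | i \in t]| = ('C(N, n) - 'C(N.-1, n))%N.
  have := card_subsets_split predT (fun t => i \in t).
  rewrite /= notin -cG (_ : #|[set t in G | true]| = #|G|).
    by move->; rewrite addnK.
  by apply: eq_card => t; rewrite !inE andbT.
rewrite split cG; case: n N hn {notin split cG i} => [//|m] [//|M] _ /=.
by rewrite {1}binS addKn mul_bin_diag.
Qed.

(** Inclusion-exclusion expresses this number through those of the subsets that
    avoid one or two given points.  Its independence of the pair is what the
    variance computation uses, where it multiplies the square of a vanishing
    sum. *)
Lemma card_subsets_containing2 : exists beta : nat, forall i j : 'I_N,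
  i != j -> #|[set t in G | (i \in t) && (j \in t)]| = beta.
Proof.
exists ('C(N, n) - 'C(N.-1, n) - ('C(N.-1, n) - 'C(N.-2, n)))%N => i j ij.
pose cnt (P : pred {set 'I_N}) := #|[set t in G | P t]|.
have split P Q :
    cnt P = (cnt (fun t => P t && Q t) + cnt (fun t => P t && ~~ Q t))%N.
  exact: card_subsets_split.
have notin (B : {set 'I_N}) :
    #|[set t in G | t \subset ~: B]| = 'C(N - #|B|, n).
  have -> : (N - #|B| = #|~: B|)%N by rewrite [RHS]cardsCs finset.setCK card_ord.
  rewrite -cards_draws.
  by apply: eq_card => t; rewrite !inE andbC.
have not1 (k : 'I_N) : cnt (fun t => k \notin t) = 'C(N.-1, n).
  rewrite -subn1 -[1%N in RHS](cards1 k) -notin /cnt; apply: eq_card => t.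
  by rewrite !inE finset.subsetC finset.sub1set inE.
have not2 : cnt (fun t => (j \notin t) && (i \notin t)) = 'C(N.-2, n).
  have := notin [set i; j]; rewrite cards2 ij subn2 => <-.
  apply: eq_card => t; rewrite !inE finset.subsetC finset.subUset.
  by rewrite !finset.sub1set !inE [(j \notin t) && _]andbC.
have cG : cnt predT = 'C(N, n).
  rewrite -[N in RHS]card_ord -card_draws /cnt.
  by apply: eq_card => t; rewrite !inE andbT.
have := split (fun t => j \notin t) (fun t => i \in t).
have := split (fun t => i \in t) (fun t => j \in t).
have : cnt predT = (cnt (fun t => i \in t) + cnt (fun t => i \notin t))%N.
  exact: split.
have -> : cnt (fun t => (j \notin t) && (i \in t)) =
    cnt (fun t => (i \in t) && (j \notin t)).
  by apply: eq_card => t; rewrite !inE [X in _ && X]andbC.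
rewrite cG !not1 not2 -/(cnt (fun t => (i \in t) && (j \in t))).
lia.
Qed.

(** For the centred function [h], the second moment of the sum over the sample
    is [(alpha - beta) * \sum_j h j ^+ 2], where [alpha] and [beta] count the
    samples containing one point and two points: sampling without
    replacement has no more variance than independent sampling. *)
Lemma sampling_variance (hn : (1 <= n <= N)%N) (g : 'I_N -> R) :
  \sum_(t in G) (n%:R^-1 * \sum_(j in t) g j - N%:R^-1 * \sum_j g j) ^+ 2 <=
  #|G|%:R * ((n%:R * N%:R)^-1 * \sum_j g j ^+ 2).
Proof.
have n0 : n%:R != 0 :> R by rewrite pnatr_eq0; lia.
have N0 : N%:R != 0 :> R by rewrite pnatr_eq0; lia.
have [beta cbeta] := card_subsets_containing2.
pose m := N%:R^-1 * \sum_j g j; pose h j := g j - m.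
have sumh : \sum_j h j = 0.
  by rewrite sumrB sumr_const card_ord -mulr_natl /m; field.
have sumh2 : \sum_j h j ^+ 2 <= \sum_j g j ^+ 2.
  have -> : \sum_j h j ^+ 2 = \sum_j g j ^+ 2 - N%:R * m ^+ 2.
    have sg : \sum_j g j = N%:R * m by rewrite /m; field.
    transitivity (\sum_j g j ^+ 2 - 2 * m * (\sum_j g j) + \sum_(j < N) m ^+ 2).
      rewrite mulr_sumr -sumrB -big_split/=; apply: eq_bigr => j _.
      by rewrite /h; ring.
    by rewrite sg sumr_const card_ord -mulr_natl; ring.
  by rewrite gerDl oppr_le0 mulr_ge0// sqr_ge0.
have Eh t : t \in G ->
    n%:R^-1 * \sum_(j in t) g j - m = n%:R^-1 * \sum_j (j \in t)%:R * h j.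
  rewrite inE => /eqP ct; rewrite (_ : \sum_j _ = \sum_(j in t) h j).
    by rewrite sumrB sumr_const ct -mulr_natl; field.
  by rewrite [RHS]big_mkcond/=; apply: eq_bigr => j _; case: (j \in t); rewrite ?mul1r ?mul0r.
rewrite -/m; under eq_bigr => t tG do rewrite Eh// exprMn.
rewrite -mulr_sumr.
(* The number of samples containing a point, from double counting. *)
have calpha j : #|[set t in G | j \in t]|%:R = n%:R * #|G|%:R / N%:R :> R.
  have /(congr1 (fun k => k%:R : R)) := card_subsets_containing hn j.
  by rewrite !natrM => <-; field.
have -> : \sum_(t in G) (\sum_j (j \in t)%:R * h j) ^+ 2 =
    \sum_j \sum_k #|[set t in G | (j \in t) && (k \in t)]|%:R * (h j * h k).
  under eq_bigr do rewrite expr2 big_distrlr/=.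
  rewrite exchange_big/=; apply: eq_bigr => j _.
  rewrite exchange_big/=; apply: eq_bigr => k _.
  rewrite -sum1_card natr_sum mulr_suml.
  rewrite [RHS](eq_bigl (fun t => (t \in G) && ((j \in t) && (k \in t))));
    last by move=> t; rewrite inE.
  rewrite big_mkcondr/=; apply: eq_bigr => t _.
  by case: (j \in t); case: (k \in t); rewrite /= ?mul1r ?mul0r ?mulr0.
have -> : \sum_j \sum_k #|[set t in G | (j \in t) && (k \in t)]|%:R * (h j * h k) =
    (n%:R * #|G|%:R / N%:R - beta%:R) * \sum_j h j ^+ 2.
  transitivity (\sum_j \sum_k (beta%:R * (h j * h k)
     + if k == j then (n%:R * #|G|%:R / N%:R - beta%:R) * h j ^+ 2 else 0)).
    apply: eq_bigr => j _; apply: eq_bigr => k _; have [->|kj] := eqVneq k j.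
      rewrite -(calpha j) (eq_card (B := [set t in G | j \in t]));
        last by move=> t; rewrite !inE andbb.
      by ring.
    by rewrite cbeta 1?eq_sym// addr0.
  under eq_bigr do rewrite big_split/= -big_mkcond/= big_pred1_eq -mulr_sumr.
  rewrite big_split/= -!mulr_sumr.
  rewrite -big_distrlr/= sumh.
  by rewrite !mul0r mulr0 add0r.
rewrite mulrA.
apply: le_trans (_ : n%:R^-1 ^+ 2 * (n%:R * #|G|%:R / N%:R) * \sum_j h j ^+ 2 <= _).
  rewrite ler_wpM2r//; first by apply: sumr_ge0 => j _; exact: sqr_ge0.
  by rewrite ler_wpM2l ?exprn_ge0 ?invr_ge0// gerBl.
rewrite (_ : _ * (_ / _) = #|G|%:R * (n%:R * N%:R)^-1);
  last by field; rewrite N0 n0.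
by rewrite mulrA ler_wpM2l// ?mulr_ge0// invr_ge0 mulr_ge0.
Qed.
End Sampling.

(** * Finite transport plans as couplings *)
Section Mixture.
Context (R : realType) (disp : measure_display) (T : measurableType disp).
Context (I : finType) (w : I -> {nonneg R}) (z : I -> T).
Local Open Scope ereal_scope.

(** Finite sums of measures run over nat, hence the enumeration of [I]; indices
    beyond its cardinal get the zero measure. *)
Definition mixture_atom (k : nat) : {measure set T -> \bar R} :=
  if insub k is Some j
  then mscale (w (enum_val (j : 'I_#|I|))) (\d_(z (enum_val j)))
  else mzero.

Definition mixture : set T -> \bar R := msum mixture_atom #|I|.

HB.instance Definition _ := Measure.copy mixture (msum mixture_atom #|I|).

Lemma mixtureE A : mixture A = \sum_i (w i)%:num%:E * \d_(z i) A.
Proof.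
rewrite [RHS](eq_bigl (fun i => i \in I))// [RHS]big_enum_val/=.
by apply: eq_bigr => k _; rewrite /mixture_atom valK.
Qed.

Lemma integral_mixture (f : T -> \bar R) :
  measurable_fun [set: T] f -> (forall x, 0 <= f x) ->
  \int[mixture]_x f x = \sum_i (w i)%:num%:E * f (z i).
Proof.
move=> mf f0; rewrite ge0_integral_measure_sum//.
rewrite [RHS](eq_bigl (fun i => i \in I))// [RHS]big_enum_val/=.
apply: eq_bigr => k _; rewrite /mixture_atom valK ge0_integral_mscale//.
by rewrite integral_dirac// diracT mul1e.
Qed.

Lemma mixture_is_probability : (\sum_i (w i)%:num = 1)%R ->
  exists P : probability T R, P = mixture :> (set T -> \bar R).
Proof.
move=> w1.
have mT : mixture setT = 1.
  rewrite mixtureE; under eq_bigr do rewrite diracT mule1.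
  by rewrite sumEFin w1.
pose isP := Measure_isProbability.Build _ _ _ mixture mT.
pose P : probability T R := HB.pack mixture isP.
by exists P.
Qed.

End Mixture.

Section DiscreteTransport.
Context (R : realType) (d : nat).
Local Notation E := (borelRV R d).

Lemma measurable_coord (i : 'I_d) :
  measurable_fun [set: E] (fun v : E => (v : 'rV[R]_d) ord0 i).
Proof.
apply: (measurability _ (RGenOpens.measurableE R)).
move=> _ [_ [a [b ->] <-]]; rewrite setTI; apply: sub_sigma_algebra.
have /continuousP := @coord_continuous R 1 d ord0 i.
by apply; exact: interval_open.
Qed.

Lemma measurable_distance :
  measurable_fun [set: E * E] (fun z : E * E =>
    euclidean_norm ((z.1 : 'rV[R]_d) - (z.2 : 'rV[R]_d))).
Proof.
apply: (@measurableT_comp _ _ _ _ _ _ (@Num.sqrt R)).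
  by apply: continuous_measurable_fun; exact: sqrt_continuous.
apply: measurable_sum => i; apply: measurable_funX.
under eq_fun do rewrite !mxE.
apply: measurable_funB.
  exact: (measurableT_comp (measurable_coord i) measurable_fst).
exact: (measurableT_comp (measurable_coord i) measurable_snd).
Qed.

Context (V : finType) (pos : V -> 'rV[R]_d).

Lemma W1_le_plan (pi : V -> V -> R) (mu nu : {measure set E -> \bar R}) :
  (forall i j, 0 <= pi i j) -> \sum_i \sum_j pi i j = 1 ->
  (forall A, mu A = \sum_i (\sum_j pi i j)%:E * \d_(pos i : E) A)%E ->
  (forall A, nu A = \sum_j (\sum_i pi i j)%:E * \d_(pos j : E) A)%E ->
  (W1 mu nu <= (\sum_i \sum_j pi i j * euclidean_norm (pos i - pos j))%:E)%E.
Proof.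
move=> pi0 pi1 muE nuE.
pose w (k : V * V) : {nonneg R} := NngNum (pi0 k.1 k.2).
pose z (k : V * V) : E * E := (pos k.1 : E, pos k.2 : E).
have [|P PE] := @mixture_is_probability R _ (E * E)%type _ w z.
  by rewrite -pi1 pair_big.
have -> : (\sum_i \sum_j pi i j * euclidean_norm (pos i - pos j))%:E =
    (\int[P]_u (euclidean_norm ((u.1 : 'rV[R]_d) - (u.2 : 'rV[R]_d)))%:E)%E.
  rewrite PE integral_mixture.
  - by rewrite pair_big -sumEFin/=; apply: eq_bigr => k _; rewrite EFinM.
  - by apply/measurable_EFinP; exact: measurable_distance.
  - by move=> u; rewrite lee_fin sqrtr_ge0.
apply: ereal_inf_lbound; exists P => //; split => A _.
  rewrite PE mixtureE muE.
  rewrite -(pair_big predT predT (fun i j =>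
    (pi i j)%:E * \d_(z (i, j)) (A `*` setT)%classic))%E/=.
  apply: eq_bigr => i _; rewrite -sumEFin ge0_sume_distrl; last first.
    by move=> j _; rewrite lee_fin.
  apply: eq_bigr => j _; congr (_ * _)%E.
  by rewrite !diracE /z; congr (_%:R%:E); rewrite in_setX/= in_setT andbT.
rewrite PE mixtureE nuE.
rewrite -(pair_big predT predT (fun i j =>
  (pi i j)%:E * \d_(z (i, j)) (setT `*` A)%classic))%E/=.
rewrite exchange_big/=.
apply: eq_bigr => i _; rewrite -sumEFin ge0_sume_distrl; last first.
  by move=> j _; rewrite lee_fin.
apply: eq_bigr => j _; congr (_ * _)%E.
by rewrite !diracE /z; congr (_%:R%:E); rewrite in_setX/= in_setT.
Qed.

End DiscreteTransport.

(** * Spreading mass on a line, one dyadic scale at a time *)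
Section DyadicLine.
Context (R : realFieldType).
Implicit Types k a b : nat.

(** The density at [b] of the uniform law on the dyadic block of length
    [2 ^ k] that contains [a]. *)
Definition block_density k a b : R :=
  if (a %/ 2 ^ k == b %/ 2 ^ k)%N then 2^-1 ^+ k else 0.

(** The distance from [b] to the multiples of [2 ^ k.+1]. *)
Definition tent k b : nat :=
  minn (b %% 2 ^ k.+1) (2 ^ k.+1 - b %% 2 ^ k.+1).

(** The flow through the edge from [b - 1] to [b] that spreads the uniform law
    on the block of length [2 ^ k] of [a] over the enclosing block of length
    [2 ^ k.+1].  It is a difference of distribution functions, hence a tent
    peaking at 1/2 in the middle of the enclosing block; its sign is positive,
    that is, the flow goes to the right, when [a] lies in the left half. *)
Definition spread k a b : R :=
  if (a %/ 2 ^ k.+1 == b %/ 2 ^ k.+1)%N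
  then (-1) ^+ odd (a %/ 2 ^ k) * (tent k b)%:R * 2^-1 ^+ k.+1 else 0.

Lemma tent_dvd k b : (2 ^ k.+1 %| b)%N -> tent k b = 0%N.
Proof. by rewrite /tent => /eqP ->; rewrite min0n. Qed.

Lemma spread_dvd k a b : (2 ^ k.+1 %| b)%N -> spread k a b = 0.
Proof. by move=> kb; rewrite /spread tent_dvd// mulr0 mul0r if_same. Qed.

Lemma block_density0 a b : block_density 0 a b = (a == b)%:R.
Proof. by rewrite /block_density expn0 !divn1; case: eqP. Qed.

Lemma block_density_ge0 k a b : 0 <= block_density k a b.
Proof. by rewrite /block_density; case: ifP => // _; rewrite exprn_ge0. Qed.

Lemma block_density_le k a b : block_density k a b <= 2^-1 ^+ k.
Proof. by rewrite /block_density; case: ifP => // _; rewrite exprn_ge0. Qed.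

(** Conservation of mass at [b]. *)
Lemma spreadS k a b :
  spread k a b.+1 - spread k a b = block_density k a b - block_density k.+1 a b.
Proof.
rewrite /spread /block_density /tent expnS.
have : (0 < 2 ^ k)%N by rewrite expn_gt0.
move: (2 ^ k)%N => s s0.
have s20 : (0 < 2 * s)%N by lia.
have half c : (c %/ s = 2 * (c %/ (2 * s)) + (s <= c %% (2 * s)))%N.
  rewrite {1}(divn_eq c (2 * s)) mulnA divnMDl// mulnC; congr (_ + _)%N.
  have := ltn_pmod c s20; move: (c %% _)%N => r r2.
  case: leqP => sr; last by rewrite divn_small.
  by rewrite -(subnKC sr) divnDl ?dvdnn// divnn s0 divn_small//; lia.
rewrite !half; have := ltn_pmod b s20; have := ltn_pmod a s20.
set Q := (a %/ (2 * s))%N; set q := (b %/ (2 * s))%N.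
set e := (s <= a %% (2 * s))%N.
have -> : odd (2 * Q + e) = e by rewrite oddD oddM/= oddb.
have bE := divn_eq b (2 * s); rewrite -/q in bE.
move: (b %% (2 * s))%N bE => r bE _ r2.
rewrite (_ : (if (Q == b.+1 %/ (2 * s))%N then _ else _) =
    if Q == q then (-1) ^+ e * (minn r.+1 (2 * s - r.+1))%:R * 2^-1 ^+ k.+1
    else 0 :> R); last first.
  have [r1|r1] := ltnP r.+1 (2 * s).
    by rewrite bE -addnS divnMDl// modnMDl modn_small// divn_small// addn0.
  have -> : b.+1 = (q.+1 * (2 * s))%N by rewrite mulSn; lia.
  have -> : (2 * s - r.+1 = 0)%N by lia.
  by rewrite modnMl min0n minn0 mulr0 mul0r !if_same.
have [->|Qq] := eqVneq Q q; last first.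
  by rewrite subrr (_ : (_ == _) = false) ?subrr//; apply/negbTE; lia.
rewrite eqn_add2l.
have -> : 2^-1 ^+ k = 2 * 2^-1 ^+ k.+1 :> R by rewrite exprS; field.
have [sr|rs] := leqP s r.
  have -> : minn r.+1 (2 * s - r.+1) = (2 * s - r.+1)%N by lia.
  have -> : minn r (2 * s - r) = (2 * s - r.+1).+1%N by lia.
  by rewrite -natr1; case: e => /=; rewrite ?expr1 ?expr0; ring.
have -> : minn r.+1 (2 * s - r.+1) = r.+1 by lia.
have -> : minn r (2 * s - r) = r by lia.
by rewrite -natr1; case: e => /=; rewrite ?expr1 ?expr0; ring.
Qed.

Lemma normr_spread_le k a b :
  `|spread k a b.+1| <= 2 ^+ k * block_density k.+1 a b.
Proof.
have [kb|kb] := boolP (2 ^ k.+1 %| b.+1)%N.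
  by rewrite spread_dvd// normr0 mulr_ge0 ?exprn_ge0 ?block_density_ge0.
rewrite /spread /block_density.
have -> : (b.+1 %/ 2 ^ k.+1 = b %/ 2 ^ k.+1)%N.
  by rewrite divnS ?expn_gt0// (negPf kb).
case: ifP => _; last by rewrite normr0 mulr0.
have h0 : 0 <= 2^-1 ^+ k.+1 :> R by exact: exprn_ge0.
rewrite !normrM normr_sign mul1r normr_nat (ger0_norm h0) ler_wpM2r//.
by rewrite -natrX ler_nat /tent expnS; lia.
Qed.

(** By [spreadS], spreading moves mass inside the line without crossing its
    ends, so the total mass is the same at all scales; at scale 0 it is a unit
    mass at [a]. *)
Lemma sum_block_density L k a : (k <= L)%N -> (a < 2 ^ L)%N ->
  \sum_(b < 2 ^ L) block_density k a b = 1.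
Proof.
elim: k => [_ aL|k IH kL aL].
  rewrite (bigD1 (Ordinal aL))//= block_density0 eqxx big1 ?addr0// => b ba.
  rewrite block_density0 (_ : (_ == _) = false)//; apply/negbTE.
  by apply: contra ba => /eqP ab; apply/eqP/val_inj.
rewrite -(IH (ltnW kL) aL); apply/esym/eqP; rewrite -subr_eq0 -sumrB.
under eq_bigr do rewrite -spreadS.
rewrite -(big_mkord predT (fun b => spread k a b.+1 - spread k a b)).
by rewrite telescope_sumr// !spread_dvd ?subrr// dvdn_exp2l.
Qed.

End DyadicLine.

(** * Spreading mass on the grid *)
Section GridFlow.
Context (R : realFieldType) (d L : nat).
Local Notation side := (2 ^ L)%N.
Local Notation grid := {ffun 'I_d -> 'I_side}.
Implicit Types (p q : grid) (i j : 'I_d) (k : nat).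

(** The law of a unit mass from [p] when its first [m] coordinates have reached
    scale [k + 1] and the others are still at scale [k]. *)
Definition stage_density k (m : nat) p q : R :=
  \prod_(j < d) block_density R (k + (j < m)) (p j) (q j).

(** Neighbours are taken cyclically so that steps are bijections.  The flow
    vanishes on the edges that wrap around ([spread_flow_wrap]). *)
Definition grid_step i q : grid :=
  [ffun j => if j == i then ordS (q j) else q j].

Definition grid_back i q : grid :=
  [ffun j => if j == i then ord_pred (q j) else q j].

(** The flow from [q] to [grid_step i q] while coordinate [i] passes from scale
    [k] to scale [k + 1]. *)
Definition spread_flow k i p q : R :=
  (\prod_(j < d | j != i) block_density R (k + (j < i)) (p j) (q j)) *
  spread R k (p i) (q i).+1.

Definition grid_flow p i q : R := \sum_(k < L) spread_flow k i p q.

Lemma grid_stepK i : cancel (grid_step i) (grid_back i).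
Proof.
by move=> q; apply/ffunP => j; rewrite !ffunE; case: eqP; rewrite ?ordSK.
Qed.

Lemma grid_backK i : cancel (grid_back i) (grid_step i).
Proof.
by move=> q; apply/ffunP => j; rewrite !ffunE; case: eqP; rewrite ?ord_predK.
Qed.

Lemma spread_flow_wrap k i p q : (k < L)%N -> ((q i).+1 = side) ->
  spread_flow k i p q = 0.
Proof. by move=> kL qi; rewrite /spread_flow qi spread_dvd ?mulr0// dvdn_exp2l. Qed.

(** At both ends of the line the tent is 0, hence the cyclic predecessor
    gives the right inflow even at the end where it wraps around. *)
Lemma spread_ord_pred k a (b : 'I_side) : (k < L)%N ->
  spread R k a (ord_pred b).+1 = spread R k a b.
Proof.
move=> kL; have [b0|b0] := posnP b.
  rewrite (_ : (ord_pred b).+1 = side).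
    by rewrite b0 !spread_dvd// dvdn_exp2l.
  have : (0 < side)%N by rewrite expn_gt0.
  by move=> s0; rewrite /= b0 add0n modn_small; lia.
congr spread; rewrite /= -[val b]prednK// addSn/= modnDr modn_small//.
by apply: leq_ltn_trans (ltn_ord b); exact: leq_pred.
Qed.

Lemma spread_flow_div k i p q : (k < L)%N ->
  spread_flow k i p q - spread_flow k i p (grid_back i q) =
  stage_density k i p q - stage_density k i.+1 p q.
Proof.
move=> kL; rewrite /stage_density [X in _ = X - _](bigD1 i)//=.
rewrite [X in _ = _ - X](bigD1 i)//= ltnn addn0 ltnSn addn1.
have -> : \prod_(j < d | j != i) block_density R (k + (j < i.+1)) (p j) (q j) =
    \prod_(j < d | j != i) block_density R (k + (j < i)) (p j) (q j).
  apply: eq_bigr => j ji; congr block_density; congr (_ + _)%N.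
  by rewrite ltnS leq_eqVlt val_eqE (negPf ji).
rewrite -mulrBl -spreadS /spread_flow ffunE eqxx spread_ord_pred//.
rewrite [X in _ - X * _ = _](eq_bigr
  (fun j => block_density R (k + (j < i)) (p j) (q j))).
  by ring.
by move=> j /negPf ji; rewrite ffunE ji.
Qed.

Lemma stageS k p q : stage_density k d p q = stage_density k.+1 0 p q.
Proof.
by apply: eq_bigr => j _; rewrite ltn_ord addn1 addn0.
Qed.

Lemma stage00 p q : stage_density 0 0 p q = (p == q)%:R.
Proof.
rewrite /stage_density; under eq_bigr do rewrite block_density0.
have [->|pq] := eqVneq p q; first by rewrite big1// => j _; rewrite eqxx.
have [j pqj] : exists j, p j != q j.
  apply/existsP; apply: contraNT pq; rewrite negb_exists => /forallP pq.
  by apply/eqP/ffunP => j; apply/eqP; rewrite -[_ == _]negbK.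
rewrite (bigD1 j)//= (_ : (p j == q j :> nat) = false) ?mul0r//.
exact: negbTE.
Qed.

Lemma stageL0 p q : stage_density L 0 p q = (2^-1 ^+ L) ^+ d.
Proof.
rewrite /stage_density -[d in RHS]card_ord -prodr_const; apply: eq_bigr => j _.
by rewrite addn0 /block_density !divn_small// eqxx.
Qed.

Lemma spread_flow_by_parts k i p (psi : grid -> R) : (k < L)%N ->
  \sum_q spread_flow k i p q * (psi q - psi (grid_step i q)) =
  \sum_q (stage_density k i p q - stage_density k i.+1 p q) * psi q.
Proof.
move=> kL; under [RHS]eq_bigr do rewrite -spread_flow_div// mulrBl.
under [LHS]eq_bigr do rewrite mulrBr.
rewrite !sumrB; congr (_ - _).
rewrite (reindex (grid_back i))/=; last first.
  by exists (grid_step i) => q _; [exact: grid_backK|exact: grid_stepK].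
by under eq_bigr do rewrite grid_backK.
Qed.

(** The stages telescope, first along the coordinates and then along the
    scales, from a unit mass at [p] to the uniform law on the grid. *)
Lemma grid_flow_div p (psi : grid -> R) :
  \sum_(i < d) \sum_q grid_flow p i q * (psi q - psi (grid_step i q)) =
  psi p - (2^-1 ^+ L) ^+ d * \sum_q psi q.
Proof.
transitivity (\sum_(k < L) \sum_(i < d) \sum_q
    (stage_density k i p q - stage_density k i.+1 p q) * psi q).
  rewrite [RHS]exchange_big/=; apply: eq_bigr => i _.
  under [RHS]eq_bigr do rewrite -spread_flow_by_parts//.
  rewrite [RHS]exchange_big/=; apply: eq_bigr => q _.
  by rewrite mulr_suml.
pose S k m := \sum_q stage_density k m p q * psi q.
transitivity (\sum_(k < L) (S k 0%N - S k.+1 0%N)).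
  apply: eq_bigr => k _.
  transitivity (\sum_(i < d) (S k i - S k i.+1)).
    apply: eq_bigr => i _; rewrite -sumrB; apply: eq_bigr => q _.
    by rewrite mulrBl.
  rewrite -(big_mkord predT (fun m : nat => S k m - S k m.+1)) -[LHS]opprK -sumrN.
  under eq_bigr do rewrite opprB.
  rewrite telescope_sumr// opprB; congr (_ - _).
  by apply: eq_bigr => q _; rewrite stageS.
rewrite -(big_mkord predT (fun k => S k 0%N - S k.+1 0%N)) -[LHS]opprK -sumrN.
under eq_bigr do rewrite opprB.
rewrite telescope_sumr// opprB; congr (_ - _).
  rewrite /S (bigD1 p)//= stage00 eqxx mul1r big1 ?addr0// => q qp.
  by rewrite stage00 eq_sym (negPf qp) mul0r.
by rewrite /S mulr_sumr; apply: eq_bigr => q _; rewrite stageL0.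
Qed.

Lemma stage_ge0 k m p q : 0 <= stage_density k m p q.
Proof. by apply: prodr_ge0 => j _; exact: block_density_ge0. Qed.

Lemma sum_stage k m p : (k < L)%N -> \sum_q stage_density k m p q = 1.
Proof.
move=> kL; rewrite /stage_density.
rewrite -(bigA_distr_bigA (fun j (b : 'I_side) =>
  block_density R (k + (j < m)) (p j) b))/=.
rewrite big1// => j _; rewrite sum_block_density//.
by case: (_ < _)%N; rewrite ?addn1 ?addn0// ltnW.
Qed.

(** A flow of at most 1/2 along a block of length [2 ^ k.+1] is at most
    [2 ^ k] times the uniform density on that block. *)
Lemma normr_spread_flow_le k i p q :
  `|spread_flow k i p q| <= 2 ^+ k * stage_density k i.+1 p q.
Proof.
rewrite /stage_density (bigD1 i)//= ltnSn addn1 mulrA mulrC /spread_flow normrM.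
have -> : \prod_(j < d | j != i) block_density R (k + (j < i.+1)) (p j) (q j) =
    \prod_(j < d | j != i) block_density R (k + (j < i)) (p j) (q j).
  apply: eq_bigr => j ji; congr block_density; congr (_ + _)%N.
  by rewrite ltnS leq_eqVlt val_eqE (negPf ji).
have P0 : 0 <= \prod_(j < d | j != i) block_density R (k + (j < i)) (p j) (q j).
  by apply: prodr_ge0 => j _; exact: block_density_ge0.
by rewrite (ger0_norm P0) ler_wpM2l// normr_spread_le.
Qed.

(** The [i + 1] coordinates that have reached the next scale each contribute an
    additional factor 1/2, which makes the energies of the [d] directions
    summable without a factor [d]. *)
Lemma stage_le k i p q :
  stage_density k i.+1 p q <= (2^-1 ^+ d) ^+ k * 2^-1 ^+ i.+1.
Proof.
have lt_count n m : (\sum_(j < n) (j < m) = minn n m)%N.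
  elim: n => [|n IH]; first by rewrite big_ord0 min0n.
  by rewrite big_ord_recr/= IH; lia.
apply: le_trans (_ : \prod_(j < d) 2^-1 ^+ (k + (j < i.+1)) <= _).
  by apply: ler_prod => j _; rewrite block_density_ge0 block_density_le.
rewrite prodrXr big_split/= sum_nat_const card_ord lt_count.
by rewrite (minn_idPr _)// exprD -exprM.
Qed.

(** With [h k] the bound on the flow at scale [k], and [H m] the sum of [h k]
    over [k < m], adding scale [m] increases the energy by the sum of
    [h m * (2 * H m + h m)].  This is at most the sup norm of [h m] times the
    l1 norm of [2 * H m + h m], which is at most [3 * 2 ^ m]: the l1 norms of
    the smaller scales add up geometrically. *)
Lemma sum_sqr_grid_flow_dir i p :
  \sum_q grid_flow p i q ^+ 2 <=
  3 * 2^-1 ^+ i.+1 * \sum_(k < L) (4 * 2^-1 ^+ d) ^+ k.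
Proof.
pose h k q := 2 ^+ k * stage_density k i.+1 p q.
have h0 k q : 0 <= h k q by rewrite mulr_ge0 ?exprn_ge0 ?stage_ge0.
have sumh k : (k < L)%N -> \sum_q h k q = 2 ^+ k.
  by move=> kL; rewrite -mulr_sumr sum_stage// mulr1.
pose H m q := \sum_(k < m) h k q.
apply: le_trans (_ : \sum_q H L q ^+ 2 <= _).
  apply: ler_sum => q _; rewrite -[leLHS]real_normK ?num_real//.
  rewrite lerXn2r ?nnegrE ?sumr_ge0// (le_trans (ler_norm_sum _ _ _))//.
  by apply: ler_sum => k _; exact: normr_spread_flow_le.
(* Induction on the number of scales rather than on [L], on which the type
   of the grid depends. *)
suff main m : (m <= L)%N -> \sum_q H m q ^+ 2 <=
    3 * 2^-1 ^+ i.+1 * \sum_(k < m) (4 * 2^-1 ^+ d) ^+ k by exact: main.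
elim: m => [_|m IH mL].
  rewrite [leRHS](_ : _ = 0) ?big_ord0 ?mulr0// big1// => q _.
  by rewrite /H big_ord0 expr0n.
rewrite big_ord_recr/= mulrDr.
have -> : \sum_q H m.+1 q ^+ 2 =
    \sum_q H m q ^+ 2 + \sum_q h m q * (2 * H m q + h m q).
  rewrite -big_split/=; apply: eq_bigr => q _.
  by rewrite /H big_ord_recr/=; ring.
apply: lerD; first exact: IH (ltnW mL).
have hle q : h m q <= 2 ^+ m * ((2^-1 ^+ d) ^+ m * 2^-1 ^+ i.+1).
  by rewrite ler_wpM2l ?exprn_ge0// stage_le.
have H0 q : 0 <= H m q by apply: sumr_ge0.
apply: le_trans (_ : \sum_q (2 ^+ m * ((2^-1 ^+ d) ^+ m * 2^-1 ^+ i.+1)) *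
    (2 * H m q + h m q) <= _).
  by apply: ler_sum => q _; rewrite ler_wpM2r// addr_ge0// mulr_ge0.
rewrite -mulr_sumr big_split/= -mulr_sumr sumh//.
have -> : \sum_q H m q = 2 ^+ m - 1.
  rewrite exchange_big/=; elim: m mL {IH H0 hle} => [_|m IH mL].
    by rewrite big_ord0 expr0 subrr.
  by rewrite big_ord_recr/= IH ?sumh 1?ltnW// exprS; ring.
rewrite exprMn (_ : 4 = 2 * 2) ?exprMn; last by rewrite -natrM.
set x := 2 ^+ m; set y := (2^-1 ^+ d) ^+ m; set z := 2^-1 ^+ i.+1.
have x0 : 0 <= x by exact: exprn_ge0.
have y0 : 0 <= y by rewrite !exprn_ge0.
have z0 : 0 <= z by exact: exprn_ge0.
have -> : 3 * z * (x * x * y) = x * (y * z) * (3 * x) by ring.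
rewrite ler_wpM2l ?mulr_ge0//; lra.
Qed.

End GridFlow.

(** * Bounding W1 by the cost of a flow *)
Section FlowBound.
Context (R : realType) (d : nat) (V Ed : finType) (pos : V -> 'rV[R]_d).
Context (src tgt : Ed -> V) (f : Ed -> R) (a b : V -> R).
Local Notation E := (borelRV R d).

Lemma sum_transport (s t : Ed -> V) (w : Ed -> R) (phi : V -> V -> R) :
  \sum_i \sum_j (\sum_e if (s e == i) && (t e == j) then w e else 0) * phi i j =
  \sum_e w e * phi (s e) (t e).
Proof.
under eq_bigr do under eq_bigr do rewrite mulr_suml.
under eq_bigr do rewrite exchange_big/=.
rewrite exchange_big/=; apply: eq_bigr => e _.
rewrite (bigD1 (s e))//= [X in _ + X]big1 ?addr0; last first.
  by move=> i si; rewrite big1// => j _; rewrite eq_sym (negPf si) mul0r.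
rewrite (bigD1 (t e))//= !eqxx [X in _ + X]big1 ?addr0// => j tj.
by rewrite eq_sym (negPf tj) mul0r.
Qed.

(** An edge traversed with negative flow is used in the opposite direction,
    which gives a nonnegative flow of the same cost on the complete graph over
    the vertices; [plan_of_flow] then yields a coupling. *)
Lemma W1_le_flow (mu nu : {measure set E -> \bar R}) :
  (forall v, 0 <= a v) -> (forall v, 0 <= b v) -> \sum_v a v = 1 ->
  (forall psi : V -> R,
    \sum_e f e * (psi (src e) - psi (tgt e)) = \sum_v (a v - b v) * psi v) ->
  (forall A, mu A = \sum_v (a v)%:E * \d_(pos v : E) A)%E ->
  (forall A, nu A = \sum_v (b v)%:E * \d_(pos v : E) A)%E ->
  (W1 mu nu <=
   (\sum_e `|f e| * euclidean_norm (pos (src e) - pos (tgt e)))%:E)%E.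
Proof.
move=> a0 b0 a1 div muE nuE.
pose c u v := euclidean_norm (pos u - pos v).
have c_refl u : c u u = 0 by rewrite /c subrr euclidean_norm0.
have c_tri u v w : c u w <= c u v + c v w.
  by rewrite /c -(subrKA (pos v)) euclidean_normD.
have c_sym u v : c u v = c v u.
  by rewrite /c /euclidean_norm; congr Num.sqrt; apply: eq_bigr => i _;
    rewrite !mxE -sqrrN opprB.
pose fp e := Num.max (f e) 0; pose fn e := Num.max (- f e) 0.
have fp0 e : 0 <= fp e by rewrite le_max lexx orbT.
have fn0 e : 0 <= fn e by rewrite le_max lexx orbT.
have fB e : fp e - fn e = f e.
  by rewrite /fp /fn; case: (leP (f e) 0) => f0; case: (leP (- f e) 0); lra.
have fD e : fp e + fn e = `|f e|.
  rewrite /fp /fn; case: (leP (f e) 0) => f0; case: (leP (- f e) 0) => f1.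
  - by rewrite (_ : f e = 0) ?normr0 ?addr0//; lra.
  - by rewrite ler0_norm// add0r.
  - by rewrite gtr0_norm// addr0.
  - lra.
pose theta i j := (\sum_e if (src e == i) && (tgt e == j) then fp e else 0) +
  \sum_e if (tgt e == i) && (src e == j) then fn e else 0.
have theta0 i j : 0 <= theta i j.
  by rewrite addr_ge0// sumr_ge0// => e _; case: ifP.
have thetaE phi : \sum_i \sum_j theta i j * phi i j =
    \sum_e (fp e * phi (src e) (tgt e) + fn e * phi (tgt e) (src e)).
  under eq_bigr do under eq_bigr do rewrite mulrDl.
  under eq_bigr do rewrite big_split/=.
  by rewrite big_split/= !sum_transport -big_split.
have net psi : \sum_i \sum_j theta i j * (psi i - psi j) =
    \sum_v (a v - b v) * psi v.
  rewrite -div (thetaE (fun i j => psi i - psi j)); apply: eq_bigr => e _.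
  by rewrite -fB; ring.
have [pi [pi0 pia pib pic]] := plan_of_flow c_refl c_tri a0 b0 theta0 net.
have -> : \sum_e `|f e| * euclidean_norm (pos (src e) - pos (tgt e)) =
    \sum_i \sum_j theta i j * c i j.
  rewrite thetaE; apply: eq_bigr => e _.
  by rewrite -fD mulrDl [c (tgt e) _]c_sym.
apply: (@le_trans _ _ (\sum_i \sum_j pi i j * c i j)%:E); last by rewrite lee_fin.
apply: W1_le_plan => // [|A|A].
- by rewrite -a1; apply: eq_bigr => i _; rewrite pia.
- by rewrite muE; apply: eq_bigr => i _; rewrite pia.
- by rewrite nuE; apply: eq_bigr => i _; rewrite pib.
Qed.

End FlowBound.

(** * The flow between an empirical measure and the full one *)
Section EmpiricalOnGrid.
Context (R : realType) (d N L : nat) (x : 'I_N -> 'rV[R]_d).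
Local Notation side := (2 ^ L)%N.
Local Notation grid := {ffun 'I_d -> 'I_side}.
Local Notation mesh := (2^-1 ^+ L : R).

Definition grid_point (q : grid) : 'rV[R]_d := \row_i (mesh * (q i)%:R).

(** The index is the integer part of [side * t], except that [t = 1] belongs to
    the last cell. *)
Lemma near_grid1 (t : R) : 0 <= t <= 1 ->
  exists b : 'I_side, `|t - mesh * b%:R| <= mesh.
Proof.
move=> /andP[t0 t1].
have m0 : 0 < mesh by exact: exprn_gt0.
have mM : mesh * side%:R = 1 by rewrite natrX -exprMn mulVf ?expr1n.
pose u := side%:R * t.
have u0 : 0 <= u by exact: mulr_ge0.
have tE : t = mesh * u by rewrite /u mulrA mM mul1r.
have s0 : (0 < side)%N by rewrite expn_gt0.
have [uside|uside] := ltnP (Num.truncn u) side.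
  exists (Ordinal uside) => /=; rewrite tE -mulrBr normrM (gtr0_norm m0).
  rewrite ger_pMr//; have /andP[ul ur] := truncn_itv u0.
  by move: ur; rewrite -natr1 => ur; rewrite ger0_norm; lra.
have sl : (side.-1 < side)%N by lia.
exists (Ordinal sl) => /=; have -> : t = 1.
  have /andP[ul _] := truncn_itv u0.
  have su : side%:R <= u by apply: le_trans ul; rewrite ler_nat.
  by apply/eqP; rewrite eq_le t1/= -mM tE ler_wpM2l// ltW.
rewrite -[X in X - _]mM -mulrBr normrM (gtr0_norm m0) ger_pMr//.
by rewrite -natrB ?leq_pred// (_ : (side - side.-1 = 1)%N) ?normr1//; lia.
Qed.

Hypothesis x_cube : forall (j : 'I_N) (i : 'I_d), 0 <= x j ord0 i <= 1.

Lemma near_grid (j : 'I_N) : exists q : grid,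
  euclidean_norm (x j - grid_point q) <= Num.sqrt d%:R * mesh.
Proof.
have /choice[q qP] : forall i, exists b : 'I_side,
    `|x j ord0 i - mesh * b%:R| <= mesh.
  by move=> i; exact: near_grid1.
exists [ffun i => q i]; apply: euclidean_norm_le; first exact: exprn_ge0.
by move=> i; rewrite !mxE ffunE.
Qed.

Lemma grid_step_dist (i : 'I_d) (q : grid) : (q i).+1 != side ->
  euclidean_norm (grid_point q - grid_point (grid_step i q)) = mesh.
Proof.
move=> qi; have m0 : 0 <= mesh by exact: exprn_ge0.
rewrite -[RHS](ger0_norm m0) -sqrtr_sqr /euclidean_norm; congr Num.sqrt.
rewrite (bigD1 i)//= big1 ?addr0; last first.
  by move=> j /negPf ji; rewrite !mxE ffunE ji subrr expr0n.
rewrite !mxE ffunE eqxx/= modn_small; last by rewrite ltn_neqAle qi ltn_ord.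
by rewrite -natr1; ring.
Qed.

(** The sample points are vertices of their own, besides the grid points, since
    they need not lie on the grid and may coincide. *)
Definition site (v : 'I_N + grid) : 'rV[R]_d :=
  match v with inl j => x j | inr q => grid_point q end.

Definition sample_mass (tau : {set 'I_N}) (v : 'I_N + grid) : R :=
  if v is inl j then (j \in tau)%:R / #|tau|%:R else 0.

Lemma sample_mass_ge0 (tau : {set 'I_N}) v : 0 <= sample_mass tau v.
Proof. by case: v => [j|q] //=; rewrite divr_ge0. Qed.

Lemma sum_sample_mass (tau : {set 'I_N}) (g : 'I_N -> R) :
  \sum_(j < N) sample_mass tau (inl j) * g j = #|tau|%:R^-1 * \sum_(j in tau) g j.
Proof.
rewrite [in RHS]big_mkcond/= mulr_sumr; apply: eq_bigr => j _.
by case: (j \in tau); rewrite ?mul1r ?mul0r ?mulr0.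
Qed.

Lemma sum_sample_mass1 (tau : {set 'I_N}) : (0 < #|tau|)%N ->
  \sum_(j < N) sample_mass tau (inl j) = 1.
Proof.
move=> tau0; under eq_bigr do rewrite -[sample_mass _ _]mulr1.
by rewrite (sum_sample_mass tau (fun=> 1)) sumr_const mulVf// pnatr_eq0 -lt0n.
Qed.

Lemma empiricalE (tau : {set 'I_N}) (A : set (borelRV R d)) :
  (empirical x tau A =
   \sum_v (sample_mass tau v)%:E * \d_(site v : borelRV R d) A)%E.
Proof.
rewrite big_sumType/= [X in (_ = _ + X)%E]big1 ?adde0; last first.
  by move=> q _; rewrite mul0e.
rewrite /empirical ge0_sume_distrr//.
rewrite big_mkcond/=; apply: eq_bigr => j _.
by case: (j \in tau); rewrite ?mul1r// mul0r mul0e.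
Qed.

Hypothesis N_gt0 : (0 < N)%N.
Variable cell : 'I_N -> grid.
Hypothesis cellP : forall j,
  euclidean_norm (x j - grid_point (cell j)) <= Num.sqrt d%:R * mesh.

Definition net_flow (tau : {set 'I_N}) (i : 'I_d) (q : grid) : R :=
  #|tau|%:R^-1 * \sum_(j in tau) grid_flow R (cell j) i q -
  N%:R^-1 * \sum_j grid_flow R (cell j) i q.

Lemma net_flowE tau i q : net_flow tau i q =
  \sum_j (sample_mass tau (inl j) - sample_mass [set: 'I_N] (inl j)) *
    grid_flow R (cell j) i q.
Proof.
under eq_bigr do rewrite mulrBl.
rewrite sumrB !sum_sample_mass cardsT card_ord /net_flow; congr (_ - _ * _).
by apply: eq_bigl => j; rewrite inE.
Qed.

(** Edges are of two kinds: from a sample point to its grid point, carrying the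
    signed excess of its mass, and between neighbouring grid points, carrying
    [net_flow].  The excesses sum to 0, which cancels the uniform law at which
    all the grid flows end. *)
Lemma W1_empirical_le (tau : {set 'I_N}) : (0 < #|tau|)%N ->
  (W1 (empirical x tau) (empirical x [set: 'I_N]) <=
   (2 * Num.sqrt d%:R * mesh +
    mesh * \sum_(e : 'I_d * grid) `|net_flow tau e.1 e.2|)%:E)%E.
Proof.
move=> tau0.
have setT0 : (0 < #|[set: 'I_N]|)%N by rewrite cardsT card_ord.
have m0 : 0 <= mesh by exact: exprn_ge0.
pose w j := sample_mass tau (inl j) - sample_mass [set: 'I_N] (inl j).
pose src (e : 'I_N + 'I_d * grid) : 'I_N + grid :=
  match e with inl j => inl j | inr iq => inr iq.2 end.
pose tgt (e : 'I_N + 'I_d * grid) : 'I_N + grid :=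
  match e with
  | inl j => inr (cell j) | inr iq => inr (grid_step iq.1 iq.2) end.
pose f (e : 'I_N + 'I_d * grid) : R :=
  match e with inl j => w j | inr iq => net_flow tau iq.1 iq.2 end.
have sumw : \sum_j w j = 0 by rewrite sumrB !sum_sample_mass1// subrr.
apply: le_trans (@W1_le_flow R d _ _ site src tgt f
  (sample_mass tau) (sample_mass [set: 'I_N]) _ _ _ _ _ _ _ _) _.
- by move=> v; exact: sample_mass_ge0.
- by move=> v; exact: sample_mass_ge0.
- by rewrite big_sumType/= [X in _ + X]big1// addr0 sum_sample_mass1.
- move=> psi; rewrite !big_sumType/= [X in _ = _ + X]big1 ?addr0; last first.
    by move=> q _; rewrite subrr mul0r.
  have -> : \sum_(iq : 'I_d * grid) net_flow tau iq.1 iq.2 *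
      (psi (inr iq.2) - psi (inr (grid_step iq.1 iq.2))) =
      \sum_j w j * psi (inr (cell j)).
    rewrite -(pair_big predT predT (fun i q => net_flow tau i q *
      (psi (inr q) - psi (inr (grid_step i q)))))/=.
    transitivity (\sum_j w j * \sum_(i < d) \sum_q grid_flow R (cell j) i q *
        (psi (inr q) - psi (inr (grid_step i q)))).
      under [RHS]eq_bigr do rewrite mulr_sumr.
      rewrite [RHS]exchange_big/=; apply: eq_bigr => i _.
      under [RHS]eq_bigr do rewrite mulr_sumr.
      rewrite [RHS]exchange_big/=; apply: eq_bigr => q _.
      by rewrite net_flowE mulr_suml; apply: eq_bigr => j _; rewrite mulrA.
    transitivity (\sum_j w j * (psi (inr (cell j)) -
        (2^-1 ^+ L) ^+ d * \sum_q psi (inr q))).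
      apply: eq_bigr => j _; congr (_ * _).
      exact: (grid_flow_div (cell j) (fun q => psi (inr q))).
    under [LHS]eq_bigr do rewrite mulrBr.
    by rewrite sumrB -mulr_suml sumw mul0r subr0.
  by rewrite -big_split/=; apply: eq_bigr => j _; rewrite -mulrDr subrK.
- by move=> A; exact: empiricalE.
- by move=> A; exact: empiricalE.
rewrite lee_fin big_sumType/=; apply: lerD.
  apply: le_trans (_ : \sum_j `|w j| * (Num.sqrt d%:R * mesh) <= _).
    by apply: ler_sum => j _; rewrite ler_wpM2l.
  rewrite -mulr_suml -mulrA ler_wpM2r ?mulr_ge0 ?sqrtr_ge0//.
  apply: le_trans (_ : \sum_j (sample_mass tau (inl j) +
      sample_mass [set: 'I_N] (inl j)) <= _).
    apply: ler_sum => j _; apply: le_trans (ler_normB _ _) _.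
    by rewrite !ger0_norm// sample_mass_ge0.
  by rewrite big_split/= !sum_sample_mass1.
rewrite mulr_sumr; apply: ler_sum => -[i q] _ /=.
(* An edge that wraps around is long, but carries no flow. *)
have [qi|qi] := eqVneq (q i).+1 side; last by rewrite grid_step_dist// mulrC.
rewrite (_ : net_flow tau i q = 0) ?normr0 ?mul0r ?mulr0//.
rewrite net_flowE big1// => j _; rewrite /grid_flow big1 ?mulr0// => k _.
by rewrite spread_flow_wrap.
Qed.

End EmpiricalOnGrid.

(** * The averaged bound at a given mesh *)
Section AverageBound.
Context (R : realType) (d N L n : nat) (x : 'I_N -> 'rV[R]_d).
Hypothesis hn : (1 <= n <= N)%N.
Hypothesis x_cube : forall (j : 'I_N) (i : 'I_d), 0 <= x j ord0 i <= 1.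
Local Notation mesh := (2^-1 ^+ L : R).
Local Notation G := (subsets_of_card N n).

(** An upper bound for the energy of the unit flow from any grid point. *)
Definition flow_energy : R :=
  (\sum_(i < d) 3 * 2^-1 ^+ i.+1) * \sum_(k < L) (4 * 2^-1 ^+ d) ^+ k.

(** Cauchy-Schwarz over the samples and the edges reduces the expected l1 norm
    of the net flow to its expected energy, which is computed edge by edge with
    [sampling_variance]. *)
Lemma average_W1_le :
  (average G (fun tau => W1 (empirical x tau) (empirical x [set: 'I_N])) <=
   (2 * Num.sqrt d%:R * mesh + Num.sqrt
     (mesh ^+ 2 * (d%:R * (2 ^+ L) ^+ d) * flow_energy / n%:R))%:E)%E.
Proof.
have /choice[cell cellP] := near_grid L x_cube.
have N0 : (0 < N)%N by lia.
have m0 : 0 <= mesh by exact: exprn_ge0.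
have n0 : n%:R != 0 :> R by rewrite pnatr_eq0; lia.
have N0' : N%:R != 0 :> R by rewrite pnatr_eq0; lia.
have cG : #|G|%:R != 0 :> R.
  rewrite pnatr_eq0 /subsets_of_card card_draws card_ord -lt0n bin_gt0; lia.
pose Y (tau : {set 'I_N}) : R := \sum_(e : 'I_d * {ffun 'I_d -> 'I_(2 ^ L)})
  `|net_flow R cell tau e.1 e.2|.
have avgY : #|G|%:R^-1 * \sum_(tau in G) Y tau <=
    Num.sqrt ((d%:R * (2 ^+ L) ^+ d) * flow_energy / n%:R).
  have avg0 : 0 <= #|G|%:R^-1 * \sum_(tau in G) Y tau.
    by rewrite mulr_ge0 ?invr_ge0// sumr_ge0// => t _; exact: sumr_ge0.
  rewrite -(ger0_norm avg0) -sqrtr_sqr ler_wsqrtr//.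
  have cE : #|{: 'I_d * {ffun 'I_d -> 'I_(2 ^ L)}}|%:R = d%:R * (2 ^+ L) ^+ d :> R.
    by rewrite card_prod card_ffun !card_ord natrM -!natrX.
  have flow2 (j : 'I_N) : \sum_(e : 'I_d * {ffun 'I_d -> 'I_(2 ^ L)})
      grid_flow R (cell j) e.1 e.2 ^+ 2 <= flow_energy.
    rewrite -(pair_big predT predT
      (fun i q => grid_flow R (cell j) i q ^+ 2))/= /flow_energy mulr_suml.
    by apply: ler_sum => i _; exact: sum_sqr_grid_flow_dir.
  have sumY2 : \sum_(tau in G) Y tau ^+ 2 <=
      (d%:R * (2 ^+ L) ^+ d) * (#|G|%:R * (flow_energy / n%:R)).
    apply: le_trans (_ : \sum_(tau in G) (d%:R * (2 ^+ L) ^+ d) *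
      \sum_(e : 'I_d * {ffun 'I_d -> 'I_(2 ^ L)}) net_flow R cell tau e.1 e.2 ^+ 2 <= _).
      apply: ler_sum => t _; rewrite -cE; apply: le_trans (sqr_sum_le _ _) _.
      under eq_bigr do rewrite real_normK ?num_real//.
      by [].
    rewrite -mulr_sumr ler_wpM2l ?mulr_ge0 ?exprn_ge0// exchange_big/=.
    apply: le_trans (_ : \sum_(e : 'I_d * {ffun 'I_d -> 'I_(2 ^ L)})
        #|G|%:R * ((n%:R * N%:R)^-1 *
          \sum_j grid_flow R (cell j) e.1 e.2 ^+ 2) <= _).
      apply: ler_sum => e _.
      rewrite [leLHS](_ : _ = \sum_(t in G) (n%:R^-1 *
          \sum_(j in t) grid_flow R (cell j) e.1 e.2 -
          N%:R^-1 * \sum_j grid_flow R (cell j) e.1 e.2) ^+ 2).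
        exact: sampling_variance.
      by apply: eq_bigr => t; rewrite inE => /eqP tn; rewrite /net_flow tn.
    rewrite -mulr_sumr ler_wpM2l// -mulr_sumr exchange_big/=.
    apply: le_trans (_ : (n%:R * N%:R)^-1 * \sum_(j < N) flow_energy <= _).
      by rewrite ler_wpM2l ?invr_ge0 ?mulr_ge0//; exact: ler_sum.
    rewrite sumr_const card_ord -mulr_natl le_eqVlt; apply/orP; left.
    by apply/eqP; field; rewrite N0' n0.
  rewrite exprMn.
  apply: le_trans (_ : #|G|%:R^-1 ^+ 2 * (#|G|%:R * \sum_(t in G) Y t ^+ 2) <= _).
    by rewrite ler_wpM2l ?exprn_ge0 ?invr_ge0//; exact: sqr_sum_le.
  apply: le_trans (_ : #|G|%:R^-1 ^+ 2 * (#|G|%:R * (d%:R * (2 ^+ L) ^+ d *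
      (#|G|%:R * (flow_energy / n%:R)))) <= _).
    by rewrite ler_wpM2l ?exprn_ge0 ?invr_ge0// ler_wpM2l.
  rewrite le_eqVlt; apply/orP; left; apply/eqP; field; rewrite cG n0 //.
rewrite /average; apply: le_trans (_ : ((#|G|%:R^-1)%:E *
   \sum_(t in G) (2 * Num.sqrt d%:R * mesh + mesh * Y t)%:E)%E <= _)%E.
  rewrite lee_wpmul2l// ?lee_fin ?invr_ge0//.
  apply: lee_sum => t; rewrite inE => /eqP tn.
  by apply: W1_empirical_le => //; lia.
rewrite sumEFin -EFinM lee_fin big_split/= sumr_const -mulr_sumr.
rewrite -[_ * mesh *+ _]mulr_natl mulrDr mulKf// lerD2l mulrCA.
apply: le_trans (ler_wpM2l m0 avgY) _.
rewrite -[X in X * Num.sqrt _](ger0_norm m0) -sqrtr_sqr.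
by rewrite -sqrtrM ?sqr_ge0// !mulrA.
Qed.

End AverageBound.

(** * Choice of the mesh *)
Section Numerics.
Context (R : realType).
Implicit Types (d n L : nat).

Lemma sqrt_le (y z : R) : 0 <= z -> y <= z ^+ 2 -> Num.sqrt y <= z.
Proof.
by move=> z0 yz; rewrite -(ger0_norm z0) -sqrtr_sqr ler_wsqrtr.
Qed.

Lemma mesh_side L : 2^-1 ^+ L * 2 ^+ L = 1 :> R.
Proof. by rewrite -exprMn mulVf ?expr1n. Qed.

Lemma sum_half_powers d : \sum_(i < d) 2^-1 ^+ i.+1 = 1 - 2^-1 ^+ d :> R.
Proof.
elim: d => [|d IH]; first by rewrite big_ord0 expr0 subrr.
by rewrite big_ord_recr/= IH exprS; field.
Qed.

Lemma flow_energyE d L : flow_energy R d L =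
  3 * (1 - 2^-1 ^+ d) * \sum_(k < L) (4 * 2^-1 ^+ d) ^+ k.
Proof. by rewrite /flow_energy -mulr_sumr sum_half_powers. Qed.

(** Used for d = 2, where the number of scales is about [ln n / ln 4]. *)
Lemma ln4_ge1 : 1 <= ln 4 :> R.
Proof.
pose u : R := expR 2^-1.
have u0 : 0 < u by exact: expR_gt0.
have u2 : u <= 2.
  have : 2^-1 <= expR (- 2^-1) :> R by apply: le_trans (expR_ge1Dx _); lra.
  by rewrite expRN lef_pV2// posrE.
have e4 : expR 1 <= 4 :> R.
  have -> : expR 1 = u * u by rewrite /u -expRD; congr expR; lra.
  by nra.
by rewrite -[leLHS]expRK ler_ln ?posrE ?expR_gt0.
Qed.

(** Here the flow contributes [Num.sqrt (3 / 2 / n)] whatever [L], and [n + 4]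
    scales make the cost of reaching the grid a small fraction of
    [Num.sqrt n%:R^-1]. *)
Lemma bound_dim1 n L : (1 <= n)%N -> L = (n + 4)%N ->
  2 * Num.sqrt 1%:R * 2^-1 ^+ L + Num.sqrt ((2^-1 ^+ L) ^+ 2 *
    (1%:R * (2 ^+ L) ^+ 1) * flow_energy R 1 L / n%:R) <=
  Num.sqrt (2 / n%:R).
Proof.
move=> n1 LE; set r := 2^-1 ^+ L.
have n0 : 0 < n%:R :> R by rewrite ltr0n.
have r0 : 0 < r by exact: exprn_gt0.
have rM : r * 2 ^+ L = 1 by exact: mesh_side.
pose s : R := Num.sqrt n%:R^-1.
have s0 : 0 < s by rewrite sqrtr_gt0 invr_gt0.
have s2 : s ^+ 2 = n%:R^-1 by rewrite sqr_sqrtr// invr_ge0 ltW.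
have s1 : s <= 1.
  by apply: sqrt_le => //; rewrite expr1n invf_le1// ler1n.
have rs : 16 * r <= s.
  have rn : r <= 2^-1 ^+ 4 * n%:R^-1.
    rewrite /r LE exprD mulrC ler_wpM2l// exprVn lef_pV2 ?posrE ?exprn_gt0//.
    by rewrite -natrX ler_nat ltnW// ltn_expl.
  rewrite -s2 in rn; nra.
have E : flow_energy R 1 L <= 3 / 2 * 2 ^+ L.
  rewrite flow_energyE expr1 (_ : 4 * 2^-1 = 2); last by lra.
  rewrite (_ : \sum_(k < L) 2 ^+ k = 2 ^+ L - 1); last by rewrite subrX1; ring.
  by lra.
have -> : Num.sqrt 1%:R = 1 :> R by rewrite sqrtr1.
(* 3 / 2 <= (5 / 4) ^ 2, then 5 / 4 + 2 / 16 = 11 / 8 and (11 / 8) ^ 2 <= 2 *)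
have E2 : Num.sqrt (r ^+ 2 * (1%:R * (2 ^+ L) ^+ 1) * flow_energy R 1 L / n%:R)
    <= (5 / 4) * s.
  apply: sqrt_le; first by rewrite mulr_ge0 ?ltW.
  rewrite exprMn s2 ler_wpM2r ?invr_ge0 ?ltW//.
  have -> : r ^+ 2 * (1%:R * 2 ^+ L ^+ 1) = r.
    by rewrite mul1r expr1 expr2 -mulrA rM mulr1.
  have := ler_wpM2l (ltW r0) E; rewrite [leRHS]mulrCA rM; lra.
apply: le_trans (_ : (11 / 8) * s <= _); first by lra.
rewrite -[leLHS]ger0_norm; last by rewrite mulr_ge0 ?ltW.
rewrite -sqrtr_sqr ler_wsqrtr// exprMn s2 ler_wpM2r ?invr_ge0 ?ltW//; lra.
Qed.

(** The mesh is the first power of 1/2 below [Num.sqrt n%:R^-1], and the energy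
    is 9/4 per scale. *)
Lemma bound_dim2 n L : (1 <= n)%N -> L = (trunc_log 4 n).+1 ->
  2 * Num.sqrt 2%:R * 2^-1 ^+ L + Num.sqrt ((2^-1 ^+ L) ^+ 2 *
    (2%:R * (2 ^+ L) ^+ 2) * flow_energy R 2 L / n%:R) <=
  8 * Num.sqrt ((1 + ln (2 * n%:R)) / n%:R).
Proof.
move=> n1 LE; set r := 2^-1 ^+ L.
have n0 : 0 < n%:R :> R by rewrite ltr0n.
have r0 : 0 < r by exact: exprn_gt0.
have rM : r * 2 ^+ L = 1 by exact: mesh_side.
set B := 1 + ln (2 * n%:R).
have LB : L%:R <= B.
  rewrite LE -natr1 addrC lerD2l.
  apply: le_trans (_ : (trunc_log 4 n)%:R * ln 4 <= _).
    by rewrite ler_peMr// ln4_ge1.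
  rewrite mulr_natl -lnXn// ler_ln ?posrE ?exprn_gt0 ?mulr_gt0//.
  have : (4 ^ trunc_log 4 n <= n)%N by exact: trunc_logP.
  rewrite -(ler_nat R) natrX => h; lra.
have B1 : 1 <= B by apply: le_trans LB; rewrite ler1n LE.
have r2 : r ^+ 2 <= n%:R^-1.
  rewrite /r -exprM mulnC exprM.
  have -> : 2^-1 ^+ 2 = 4^-1 :> R by lra.
  rewrite exprVn lef_pV2 ?posrE ?exprn_gt0//.
  rewrite -natrX ler_nat LE; apply: ltnW; exact: trunc_log_ltn.
have E : flow_energy R 2 L = 9 / 4 * L%:R.
  rewrite flow_energyE (_ : 4 * 2^-1 ^+ 2 = 1); last by lra.
  under eq_bigr do rewrite expr1n.
  by rewrite sumr_const card_ord; lra.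
pose t := Num.sqrt (B / n%:R).
have t0 : 0 <= t by exact: sqrtr_ge0.
have t2 : t ^+ 2 = B / n%:R by rewrite sqr_sqrtr// divr_ge0 ?ltW//; lra.
have rt : r <= t.
  rewrite /t -[r](ger0_norm (ltW r0)) -sqrtr_sqr ler_wsqrtr//.
  by apply: le_trans r2 _; rewrite ler_peMl// invr_ge0 ltW.
have q2 : Num.sqrt 2%:R <= 3 / 2 :> R by apply: sqrt_le; lra.
have E2 : Num.sqrt (r ^+ 2 * (2%:R * (2 ^+ L) ^+ 2) * flow_energy R 2 L / n%:R)
    <= 3 * t.
  apply: sqrt_le; first by rewrite mulr_ge0.
  have -> : r ^+ 2 * (2%:R * (2 ^+ L) ^+ 2) = 2.
    by rewrite mulrCA -exprMn rM expr1n mulr1.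
  by rewrite exprMn t2 [leRHS]mulrA ler_wpM2r ?invr_ge0 ?ltW// E; lra.
have : Num.sqrt 2%:R * r <= 3 / 2 * t.
  by apply: ler_pM => //; exact: ltW.
by rewrite -/t -mulrA => h; lra.
Qed.

(** The energy is bounded, and the number of cells is the largest
    power of [2 ^ d] not exceeding [n], so that both terms are of the order of
    the mesh, which is at most twice [n ^ (- 1 / d)]. *)
Lemma bound_dim_ge3 d n L : (3 <= d)%N -> (1 <= n)%N ->
  L = trunc_log (2 ^ d) n ->
  2 * Num.sqrt d%:R * 2^-1 ^+ L + Num.sqrt ((2^-1 ^+ L) ^+ 2 *
    (d%:R * (2 ^+ L) ^+ d) * flow_energy R d L / n%:R) <=
  13 * Num.sqrt d%:R / (n%:R `^ (d%:R^-1)).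
Proof.
move=> d3 n1 LE; set r := 2^-1 ^+ L.
have n0 : 0 < n%:R :> R by rewrite ltr0n.
have r0 : 0 < r by exact: exprn_gt0.
have d1 : (1 < 2 ^ d)%N by rewrite -{1}(expn0 2) ltn_exp2l; lia.
have Mn : (2 ^+ L) ^+ d <= n%:R :> R.
  by rewrite -exprM mulnC exprM -!natrX ler_nat LE trunc_logP.
have E : 0 <= flow_energy R d L <= 6.
  have x0 : 0 <= 2^-1 ^+ d :> R by exact: exprn_ge0.
  have x1 : 2^-1 ^+ d <= 2^-1 ^+ 3 :> R by apply: ler_wiXn2l => //; lra.
  have y0 : 0 <= 4 * 2^-1 ^+ d :> R by rewrite mulr_ge0.
  have S : \sum_(k < L) (4 * 2^-1 ^+ d) ^+ k <= 2 :> R.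
    apply: le_trans (_ : 2 * \sum_(k < L) 2^-1 ^+ k.+1 <= _).
      rewrite mulr_sumr; apply: ler_sum => k _.
      rewrite exprS mulrA divff// mul1r lerXn2r ?nnegrE//; lra.
    by rewrite sum_half_powers; have : 0 <= 2^-1 ^+ L :> R by []; lra.
  have S0 : 0 <= \sum_(k < L) (4 * 2^-1 ^+ d) ^+ k :> R.
    by apply: sumr_ge0 => k _; exact: exprn_ge0.
  rewrite flow_energyE; apply/andP; split; nra.
have sd0 : 0 <= Num.sqrt d%:R :> R by exact: sqrtr_ge0.
have E2 : Num.sqrt (r ^+ 2 * (d%:R * (2 ^+ L) ^+ d) * flow_energy R d L / n%:R)
    <= 5 / 2 * Num.sqrt d%:R * r.
  apply: sqrt_le; first by rewrite !mulr_ge0// ltW.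
  rewrite !exprMn sqr_sqrtr//.
  have h : (2 ^+ L) ^+ d * flow_energy R d L / n%:R <= 25 / 4.
    rewrite ler_pdivrMr//; move: E => /andP[E0 E6].
    apply: le_trans (ler_pM _ E0 Mn E6) _; first by do 2!apply: exprn_ge0.
    by lra.
  have rd : 0 <= r ^+ 2 * d%:R by rewrite mulr_ge0 ?sqr_ge0.
  by have := ler_wpM2l rd h; lra.
have rn : r <= 2 / n%:R `^ d%:R^-1.
  have p0 : 0 < n%:R `^ d%:R^-1 :> R by exact: powR_gt0.
  rewrite ler_pdivlMr//.
  have nM : n%:R <= (2 ^+ L.+1) ^+ d :> R.
    rewrite -exprM mulnC exprM -!natrX ler_nat LE ltnW//.
    exact: trunc_log_ltn.
  have dn0 : d%:R != 0 :> R by rewrite pnatr_eq0; lia.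
  have root : n%:R `^ d%:R^-1 <= 2 ^+ L.+1 :> R.
    apply: le_trans (ge0_ler_powR _ _ _ nM) _; rewrite ?invr_ge0 ?nnegrE//.
    by rewrite -powR_mulrn ?exprn_ge0// -powRrM divff// powRr1 ?exprn_ge0.
  apply: le_trans (ler_wpM2l (ltW r0) root) _.
  by rewrite exprS mulrCA mesh_side mulr1.
have sdp : 0 <= Num.sqrt d%:R / n%:R `^ d%:R^-1 :> R.
  by rewrite divr_ge0// powR_ge0.
by have := ler_wpM2l sd0 rn; move: E2; lra.
Qed.
End Numerics.

Theorem corollary5 (R : realType) (d N : nat) (hd : (1 <= d)%N)
    (hN : (2 <= N)%N) (x : 'I_N -> 'rV[R]_d)
    (hx : forall (j : 'I_N) (i : 'I_d), 0 <= x j ord0 i <= 1)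
    (n : nat) (hn : (1 <= n <= N)%N) :
  (average (subsets_of_card N n)
     (fun tau => W1 (empirical x tau) (empirical x [set: 'I_N])) <=
   (if d == 1%N then Num.sqrt (2 / n%:R)
    else if d == 2%N then 8 * Num.sqrt ((1 + ln (2 * n%:R)) / n%:R)
    else 13 * Num.sqrt d%:R / (n%:R `^ (d%:R^-1)))%:E)%E.
Proof.
have /andP[n1 _] := hn.
have [d1|d1] := eqVneq d 1%N.
  by subst d; apply: le_trans (average_W1_le (n + 4) hn hx) _;
    rewrite lee_fin bound_dim1.
have [d2|d2] := eqVneq d 2.
  subst d; apply: le_trans (average_W1_le (trunc_log 4 n).+1 hn hx) _.
  by rewrite lee_fin bound_dim2.
apply: le_trans (average_W1_le (trunc_log (2 ^ d) n) hn hx) _.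
by rewrite lee_fin bound_dim_ge3//; lia.
Qed.
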